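(* Let $\triangle$ be a regular triangulation of a polygonal domain $\Omega\subset\mathbb R^2$ and $d\ge1$. Let $D_0^{\mathrm{br}}:S^{-1}_{d+1}(\triangle)\to[S^{-1}_d(\triangle)]^2$ be the broken (triangle-by-triangle) gradient acting on coefficients. Then the global smoothness matrices satisfy $$C_1^{\mathrm{curl}}D_0^{\mathrm{br}}=B_0C_0,\qquad B_0=\operatorname{diag}_e\bigl(|e|^{-1}\mathsf U_{d+1}\bigr),$$ where $B_0$ is block diagonal over the interior edges $e$, and consequently $D_0^{\mathrm{br}}(\ker C_0)\subset\ker C_1^{\mathrm{curl}}$.
   Context: Triangulation: $\triangle$ is a finite set of nondegenerate closed triangles whose union is $\overline\Omega$, with $\Omega$ the (connected) interior of that union; any two distinct triangles meet in the empty set, a common vertex, or a common edge. An interior edge is an edge shared by two triangles $T^+,T^-$. $\mathcal P_m(T)$ is the space of polynomials of total degree at most $m$ on $T$; $S^{-1}_m(\triangle)$ is the space of families $(s|_T)_{T\in\triangle}$ with $s|_T\in\mathcal P_m(T)$, no continuity being imposed across edges. Such a family is identified with the concatenation of its B-coefficient vectors, i.e. coordinates of $s|_T$ in the Bernstein basis $\frac{m!}{i!j!k!}\lambda_1^i\lambda_2^j\lambda_3^k$, $i+j+k=m$, where $\lambda_i$ are the barycentric coordinates of $T$; vector fields have two such vectors, one per Cartesian component. Each interior edge $e$ has length $|e|$ and a fixed orientation with unit tangent $t_e$ pointing from its first endpoint $a$ to its second endpoint $b$. The degree-$m$ coefficient vector on $e$ of a polynomial $p$ of degree at most $m$ is the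 vector $(r_0,\dots,r_m)$ with $p(a+t(b-a))=\sum_j r_j\binom mj t^j(1-t)^{m-j}$ (from both sides, ordered along $t_e$). For $u\in S^{-1}_{d+1}(\triangle)$, $C_{0,e}u$ is the degree-$(d+1)$ coefficient vector on $e$ of $u|_{T^+}$ minus that of $u|_{T^-}$. For $v\in[S^{-1}_d(\triangle)]^2$, $C^{\mathrm{curl}}_{1,e}v$ is the degree-$d$ coefficient vector on $e$ of $v|_{T^+}\cdot t_e$ minus that of $v|_{T^-}\cdot t_e$. $C_0$ and $C_1^{\mathrm{curl}}$ are obtained by stacking these blocks over all interior edges. The univariate difference matrix is $\mathsf U_m\in\mathbb R^{m\times(m+1)}$, $(\mathsf U_m r)_j=m(r_{j+1}-r_j)$, $j=0,\dots,m-1$. *)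

(* Defs.v *)
From HB Require Import structures.
From mathcomp Require Import all_boot all_order all_algebra.
From mathcomp Require Import all_classical all_reals all_analysis.
(* mpoly and analysis have clashing notations. *)
From mathcomp Require Import -(notations) mpoly.
From mathcomp Require Import ring.

Set Implicit Arguments.
Unset Strict Implicit.
Unset Printing Implicit Defensive.

Import Order.TTheory GRing.Theory Num.Theory.
Import numFieldNormedType.Exports.

Local Open Scope classical_set_scope.
Local Open Scope ring_scope.

(** * Triangles and triangulations *)

Definition hull (R : realType) n (v : 'I_n -> 'rV[R]_2) : set 'rV[R]_2 :=
  [set x | exists l : 'I_n -> R,
    [/\ forall i, 0 <= l i, \sum_i l i = 1 & x = \sum_i l i *: v i]].

Definition seg (R : realType) (a b : 'rV[R]_2) : set 'rV[R]_2 :=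
  hull (fun i : 'I_2 => if i == ord0 then a else b).

(* The [i]-th row is (1, x_i, y_i), for [v i] = (x_i, y_i). *)
Definition vertex_mx (R : realType) (v : 'I_3 -> 'rV[R]_2) : 'M[R]_(1 + 2) :=
  \matrix_i row_mx 1%:M (v i).

Record triangle (R : realType) := Triangle {
  vertex :> 'I_3 -> 'rV[R]_2;
  nondegenerate : vertex_mx vertex \in unitmx }.

Definition is_edge (R : realType) (T : triangle R) (a b : 'rV[R]_2) :=
  exists i j : 'I_3, [/\ i != j, a = T i & b = T j].

Definition meet_regularly (R : realType) (T T' : triangle R) :=
  [\/ hull T `&` hull T' = set0,
      exists i j, T i = T' j /\ hull T `&` hull T' = [set T i]
    | exists a b, [/\ is_edge T a b, is_edge T' a b &
                      hull T `&` hull T' = seg a b]].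

(* No triangle is listed twice: two equal triangles do not meet regularly. *)
Definition regular_triangulation (R : realType) n (T : 'I_n -> triangle R)
    (Omega : set 'rV[R]_2) :=
  [/\ closure Omega = \bigcup_i hull (T i),
      Omega = interior (\bigcup_i hull (T i)),
      Omega !=set0 /\ connected Omega &
      forall i j, i != j -> meet_regularly (T i) (T j)].

(* An enumeration, without repetition, of the edges shared by two triangles,
   with an arbitrary choice, for each of them, of which triangle is T^+ and
   which end point comes first. *)
Record interior_edges (R : realType) n (T : 'I_n -> triangle R) :=
  InteriorEdges {
    nedge : nat;
    tplus : 'I_nedge -> 'I_n;
    tminus : 'I_nedge -> 'I_n;
    eorg : 'I_nedge -> 'rV[R]_2;
    edst : 'I_nedge -> 'rV[R]_2;
    tplus_neq_tminus : forall e, tplus e != tminus e;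
    tplus_edge : forall e, is_edge (T (tplus e)) (eorg e) (edst e);
    tminus_edge : forall e, is_edge (T (tminus e)) (eorg e) (edst e);
    interior_edges_enum : forall i j a b, i != j ->
      is_edge (T i) a b -> is_edge (T j) a b ->
      exists! e, [set eorg e; edst e] = [set a; b] }.

(** * Bernstein bases *)

Section Bernstein.
Variable R : realType.

Definition peval (p : mpoly 2 R) (x : 'rV[R]_2) : R :=
  meval (fun k => x 0 k) p.

(* The barycentric coordinates solve (1, X, Y) = (lambda_i)_i *m vertex_mx T. *)
Definition bary (T : triangle R) (i : 'I_3) : mpoly 2 R :=
  mpolyC 2 (invmx (vertex_mx T) 0 i) +
  \sum_(k < 2) invmx (vertex_mx T) (lift ord0 k) i *: mpolyX R (mnm1 k).

Definition bidx m : {set {ffun 'I_3 -> 'I_m.+1}} :=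
  [set al : {ffun 'I_3 -> 'I_m.+1} | (\sum_i al i == m)%N].

Definition bernstein (T : triangle R) m (al : {ffun 'I_3 -> 'I_m.+1}) :
    mpoly 2 R :=
  (m`!%:R / (\prod_i (al i)`!)%:R) *: \prod_i bary T i ^+ al i.

(* The dimension of P_m and the polynomial with given B-coefficients. *)
Definition bdim m := #|bidx m|.

Definition bpoly (T : triangle R) m (c : 'cV[R]_(bdim m)) : mpoly 2 R :=
  \sum_k c k 0 *: bernstein T (enum_val k).

(* Coordinates of [p], of degree at most m, in the Bernstein basis; they are
   unique and linear in [p] by [bpoly_inj] and [bcoefK]. *)
Definition bcoef (T : triangle R) m (p : mpoly 2 R) : 'cV[R]_(bdim m) :=
  xget 0 [set c | bpoly T c = p].

Definition edge_poly m (r : 'cV[R]_m.+1) (t : R) : R :=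
  \sum_(j < m.+1) r j 0 * 'C(m, j)%:R * t ^+ j * (1 - t) ^+ (m - j).

Definition edge_coef m (a b : 'rV[R]_2) (p : mpoly 2 R) : 'cV[R]_m.+1 :=
  xget 0 [set r | forall t, peval p (a + t *: (b - a)) = edge_poly r t].

(* The Euclidean norm: [`|v|] is the sup norm on 'rV_2. *)
Definition elen (a b : 'rV[R]_2) : R :=
  Num.sqrt (\sum_k (b 0 k - a 0 k) ^+ 2).

Definition tangent (a b : 'rV[R]_2) : 'rV[R]_2 := (elen a b)^-1 *: (b - a).

End Bernstein.

(** * Smoothness matrices *)

Section Matrices.
Variables (R : realType) (n : nat) (T : 'I_n -> triangle R).
Variable E : interior_edges T.

(* The matrix of a linear map between spaces of column vectors. *)
Definition matrix_of p q (f : 'cV[R]_q -> 'cV[R]_p) : 'M[R]_(p, q) :=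
  \matrix_(i, j) f (delta_mx j 0) i 0.

(* S^{-1}_m, as a space of stacked B-coefficient vectors. *)
Definition sdim m : nat := \sum_(i < n) bdim m.
Definition spline m := 'cV[R]_(sdim m).
Definition spiece m (u : spline m) (i : 'I_n) : mpoly 2 R :=
  bpoly (T i) (submxcol u i).

(* [S^{-1}_m]^2: the coefficients of the x-components are stacked over those
   of the y-components. *)
Definition vspline m := 'cV[R]_(sdim m + sdim m).
Definition vpiece_dot m (v : vspline m) (i : 'I_n) (w : 'rV[R]_2) :
    mpoly 2 R :=
  w 0 0 *: spiece (usubmx v) i + w 0 1 *: spiece (dsubmx v) i.

Definition broken_partial d (k : 'I_2) (u : spline d.+1) : spline d :=
  \mxcol_i bcoef (T i) d (mderiv k (spiece u i)).
Definition broken_grad d (u : spline d.+1) : vspline d :=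
  col_mx (broken_partial 0 u) (broken_partial 1 u).

Definition edge_jump m (e : 'I_(nedge E)) (u : spline m) : 'cV[R]_m.+1 :=
  edge_coef m (eorg e) (edst e) (spiece u (tplus e))
  - edge_coef m (eorg e) (edst e) (spiece u (tminus e)).
Definition jump m (u : spline m) : 'cV[R]_(\sum_(e < nedge E) m.+1) :=
  \mxcol_e edge_jump e u.

Definition edge_tangential_jump m (e : 'I_(nedge E)) (v : vspline m) :
    'cV[R]_m.+1 :=
  let t := tangent (eorg e) (edst e) in
  edge_coef m (eorg e) (edst e) (vpiece_dot v (tplus e) t)
  - edge_coef m (eorg e) (edst e) (vpiece_dot v (tminus e) t).
Definition tangential_jump m (v : vspline m) :
    'cV[R]_(\sum_(e < nedge E) m.+1) :=
  \mxcol_e edge_tangential_jump e v.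

Definition D0br d := matrix_of (@broken_grad d).
Definition C0 m := matrix_of (@jump m).
Definition C1curl m := matrix_of (@tangential_jump m).

Definition Udiff m : 'M[R]_(m, m.+1) :=
  m%:R *: \matrix_(i < m, j < m.+1) ((j == i.+1 :> nat)%:R - (j == i :> nat)%:R).

Definition B0 d :
    'M[R]_(\sum_(e < nedge E) d.+1, \sum_(e < nedge E) d.+2) :=
  \mxblock_(e < nedge E, e' < nedge E)
    (if e == e' then (elen (eorg e) (edst e))^-1 *: Udiff d.+1 else 0).

End Matrices.

(** * The coordinates are well defined and the operators are linear *)

Section WellDefined.
Variable R : realType.

Lemma poly_nat0 (p : {poly R}) : (forall k : nat, p.[k%:R] = 0) -> p = 0.
Proof.
move=> p0; apply/eqP/negPn/negP => pn0.
have := max_poly_roots (rs := [seq k%:R | k <- iota 0 (size p)]) pn0.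
rewrite size_map size_iota ltnn => F; suff: false by [].
apply: F; first by apply/allP => _ /mapP[k _ ->]; rewrite /root p0.
by rewrite map_inj_uniq ?iota_uniq// => x y /eqP; rewrite eqr_nat => /eqP.
Qed.

Lemma sum_powers0 (I : finType) (c : I -> R) (f : I -> nat) :
  (forall k : nat, \sum_i c i * k%:R ^+ f i = 0) ->
  forall j, \sum_(i | f i == j) c i = 0.
Proof.
move=> h j; pose p : {poly R} := \sum_i c i *: 'X^(f i).
have p0 : p = 0.
  apply: poly_nat0 => k; rewrite horner_sum -[RHS](h k).
  by apply: eq_bigr => i _; rewrite hornerZ hornerXn.
have := congr1 (fun p : {poly R} => p`_j) p0; rewrite coef0 coef_sum => H0; rewrite -[RHS]H0.
rewrite big_mkcond; apply: eq_bigr => i _; rewrite coefZ coefXn eq_sym.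
by case: ifP; rewrite ?mulr1 ?mulr0.
Qed.

Lemma bary_hull (T : triangle R) (l : 'I_3 -> R) i : \sum_j l j = 1 ->
  peval (bary T i) (\sum_j l j *: T j) = l i.
Proof.
move=> l1; set x := \sum_j _.
have H : row_mx 1%:M x = (\row_j l j) *m vertex_mx T.
  apply/rowP => k; rewrite !mxE.
  case: (@splitP 1 2 k) => j jk.
    rewrite ord1 mxE/= -l1; apply: eq_bigr => a _; rewrite !mxE.
    case: (@splitP 1 2 k) => [b _|b]; first by rewrite ord1 mxE mulr1.
    by rewrite jk ord1.
  rewrite /x summxE; apply: eq_bigr => a _; rewrite !mxE.
  case: (@splitP 1 2 k) => [b|b]; first by rewrite jk ord1.
  by rewrite jk => -[/ord_inj<-].
have /rowP/(_ i) : row_mx 1%:M x *m invmx (vertex_mx T) = \row_j l j.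
  by rewrite H mulmxK// nondegenerate.
rewrite !mxE => H0; rewrite -[RHS]H0 /peval/bary mevalD mevalC [RHS]big_ord_recl /=.
congr (_ + _).
  rewrite mxE; case: (@splitP 1 2 _) => //= j _.
  by rewrite ord1 mxE mul1r.
rewrite raddf_sum; apply: eq_bigr => k _ /=.
rewrite mevalZ mevalXU mulrC mxE; congr (_ * _).
case: (@splitP 1 2 _) => //= j; first by rewrite ord1.
by move=> [/ord_inj<-].
Qed.

Lemma peval_bpoly (T : triangle R) m (c : 'cV[R]_(bdim m)) x :
  peval (bpoly T c) x =
  \sum_k c k 0 * (m`!%:R / (\prod_i (enum_val k i)`!)%:R *
    \prod_i peval (bary T i) x ^+ enum_val k i).
Proof.
rewrite /peval /bpoly raddf_sum; apply: eq_bigr => k _ /=.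
rewrite mevalZ /bernstein mevalZ [meval _ _]rmorph_prod /=.
by congr (_ * (_ * _)); apply: eq_bigr => i _; rewrite rmorphXn.
Qed.

Lemma bpoly_is_linear (T : triangle R) m : linear (@bpoly R T m).
Proof.
move=> a c c'; rewrite /bpoly scaler_sumr -big_split; apply: eq_bigr => k _ /=.
by rewrite !mxE scalerDl scalerA.
Qed.

Lemma bidxE m (k : 'I_(bdim m)) :
  (enum_val k ord0 + enum_val k (lift ord0 ord0) + enum_val k ord_max = m)%N.
Proof.
have := enum_valP k; rewrite inE !big_ord_recl big_ord0 addn0 addnA => /eqP.
by rewrite (_ : lift ord0 (lift ord0 ord0) = ord_max)//; apply/val_inj.
Qed.

Lemma prod3 (f : 'I_3 -> R) :
  \prod_i f i = f ord0 * f (lift ord0 ord0) * f ord_max.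
Proof.
rewrite !big_ord_recl big_ord0 mulr1 mulrA.
by rewrite (_ : lift ord0 (lift ord0 ord0) = ord_max)//; apply/val_inj.
Qed.

Lemma bpoly_eq0 (T : triangle R) m (c : 'cV[R]_(bdim m)) :
  bpoly T c = 0 -> c = 0.
Proof.
move=> c0.
pose w (k : 'I_(bdim m)) : R := m`!%:R / (\prod_i (enum_val k i)`!)%:R.
have w0 k : w k != 0.
  rewrite mulf_neq0 ?invr_eq0 ?pnatr_eq0 -?lt0n ?fact_gt0//.
  by apply: prodn_gt0 => i; rewrite fact_gt0.
have H (a b : nat) : \sum_k (c k 0 * w k * b%:R ^+ enum_val k (lift ord0 ord0))
    * a%:R ^+ enum_val k ord0 = 0.
  pose z : R := 1 + a%:R + b%:R.
  have z0 : z != 0 by rewrite gt_eqF// !ltr_wpDr// ler0n.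
  pose l (i : 'I_3) : R :=
    if i == ord0 then a%:R / z else if i == ord_max then 1 / z else b%:R / z.
  have l1 : \sum_j l j = 1.
    rewrite !big_ord_recl big_ord0 /l /= addr0 -!mulrDl /z.
    by rewrite (_ : _ + _ = z) ?divff// /z; ring.
  have /(congr1 (fun p => peval p (\sum_j l j *: T j))) := c0.
  rewrite peval_bpoly /peval meval0 => /(congr1 ( *%R (z ^+ m))).
  rewrite mulr0 => H0; rewrite -[RHS]H0 mulr_sumr; apply: eq_bigr => k _.
  rewrite -/(w k) prod3 -!/(peval _ _) !bary_hull// /l /= -[in z ^+ m](bidxE k).
  rewrite !exprD !expr_div_n expr1n.
  set e0 := nat_of_ord (enum_val k ord0).
  set e1 := nat_of_ord (enum_val k (lift ord0 ord0)).
  set e2 := nat_of_ord (enum_val k ord_max).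
  clearbody z; move: (c k 0) (w k) (a%:R ^+ e0) (b%:R ^+ e1) => ck wk A B.
  have := expf_neq0 e0 z0; have := expf_neq0 e1 z0; have := expf_neq0 e2 z0.
  move: (z ^+ e0) (z ^+ e1) (z ^+ e2) => p q r p0 q0 r0.
  by field; rewrite p0 q0 r0.
have H1 b j : \sum_(k : 'I_(bdim m) | enum_val k ord0 == j :> nat)
    (c k 0 * w k * b%:R ^+ enum_val k (lift ord0 ord0)) = 0.
  exact: (@sum_powers0 _ (fun k => c k 0 * w k * _)
    (fun k => enum_val k ord0) (fun a => H a b) j).
apply/colP => k; rewrite mxE.
have : \sum_(k' : 'I_(bdim m) |
       enum_val k' (lift ord0 ord0) == enum_val k (lift ord0 ord0) :> nat)
    (if enum_val k' ord0 == enum_val k ord0 :> nat then c k' 0 * w k' else 0) = 0.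
  apply: (@sum_powers0 _ (fun k' : 'I_(bdim m) =>
    if enum_val k' ord0 == enum_val k ord0 :> nat then c k' 0 * w k' else 0)
    (fun k' => enum_val k' (lift ord0 ord0))) => b.
  rewrite -[RHS](H1 b (enum_val k ord0)) [RHS]big_mkcond.
  by apply: eq_bigr => k' _; case: ifP; rewrite ?mul0r.
rewrite -big_mkcondr (big_pred1 k).
  by move/eqP; rewrite mulf_eq0 (negPf (w0 k)) orbF => /eqP.
move=> k' /=; apply/andP/eqP => [[/eqP e1 /eqP e0]|->//].
apply: enum_val_inj; apply/ffunP => i; apply/val_inj => /=.
have e2 : enum_val k' ord_max = enum_val k ord_max :> nat.
  by apply/eqP; rewrite -(eqn_add2l (enum_val k ord0 + enum_val k (lift ord0 ord0)))
    -[in X in X == _]e0 -[in X in X == _]e1 !bidxE.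
case: (unliftP ord0 i) => [j|] -> //.
case: (unliftP ord0 j) => [j'|] -> //.
by rewrite (_ : lift ord0 (lift ord0 j') = ord_max)//; apply/val_inj; rewrite ord1.
Qed.

Lemma bpoly_inj (T : triangle R) m : injective (@bpoly R T m).
Proof.
move=> c c' h; apply/eqP; rewrite -subr_eq0; apply/eqP/(@bpoly_eq0 T).
rewrite -scaleN1r addrC; have := @bpoly_is_linear T m (-1) c' c.
by move=> ->; rewrite h scaleN1r addNr.
Qed.

Lemma bcoefK (T : triangle R) m : cancel (@bpoly R T m) (@bcoef R T m).
Proof.
move=> c; apply: (@bpoly_inj T); rewrite /bcoef.
by apply: (xgetPex 0 (P := [set c' | bpoly T c' = bpoly T c])); exists c.
Qed.

Definition bary_mono (T : triangle R) (a b c : nat) : mpoly 2 R :=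
  bary T ord0 ^+ a * bary T (lift ord0 ord0) ^+ b * bary T ord_max ^+ c.

Lemma bernsteinE (T : triangle R) m (al : {ffun 'I_3 -> 'I_m.+1}) :
  bernstein T al = (m`!%:R / (\prod_i (al i)`!)%:R) *:
    bary_mono T (al ord0) (al (lift ord0 ord0)) (al ord_max).
Proof.
congr (_ *: _); rewrite !big_ord_recl big_ord0 mulr1 mulrA.
by rewrite (_ : lift ord0 (lift ord0 ord0) = ord_max)//; apply/val_inj.
Qed.

Definition is_bpoly (T : triangle R) m (p : mpoly 2 R) :=
  exists c : 'cV[R]_(bdim m), bpoly T c = p.

Lemma is_bpolyD T m p q : is_bpoly T m p -> is_bpoly T m q -> is_bpoly T m (p + q).
Proof.
move=> [c <-] [c' <-]; exists (1 *: c + c').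
by rewrite bpoly_is_linear scale1r.
Qed.

Lemma is_bpoly0 T m : is_bpoly T m 0.
Proof. by exists 0; rewrite /bpoly big1// => k _; rewrite mxE scale0r. Qed.

Lemma is_bpolyZ T m a p : is_bpoly T m p -> is_bpoly T m (a *: p).
Proof.
move=> [c <-]; exists (a *: c).
rewrite /bpoly scaler_sumr; apply: eq_bigr => k _.
by rewrite mxE -scalerA.
Qed.

Lemma is_bpoly_mono T m a b c : (a + b + c)%N = m -> is_bpoly T m (bary_mono T a b c).
Proof.
move=> abc.
pose f (i : 'I_3) := if i == ord0 then a else if i == ord_max then c else b.
pose al : {ffun 'I_3 -> 'I_m.+1} := [ffun i => inord (f i)].
have alE i : al i = f i :> nat.
  rewrite ffunE inordK// ltnS -abc /f.
  by case: ifP => _; [|case: ifP => _]; rewrite ?leq_addl// -addnA ?leq_addr//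
    addnCA leq_addr.
have alP : al \in bidx m.
  rewrite inE !big_ord_recl big_ord0 !alE /f /= addn0 -abc addnA.
  exact: eqxx.
pose k : 'I_(bdim m) := enum_rank_in alP al.
have kE : enum_val k = al by rewrite enum_rankK_in.
pose w : R := m`!%:R / (\prod_i (al i)`!)%:R.
have w0 : w != 0.
  rewrite mulf_neq0 ?invr_eq0 ?pnatr_eq0 -?lt0n ?fact_gt0//.
  by apply: prodn_gt0 => i; rewrite fact_gt0.
exists (\col_k' (if k' == k then w^-1 else 0)).
rewrite /bpoly (bigD1 k)//= big1; last first.
  by move=> j jk; rewrite mxE (negPf jk) scale0r.
by rewrite addr0 mxE eqxx bernsteinE kE -/w scalerA mulVf// scale1r !alE.
Qed.

Lemma mderiv_bary (T : triangle R) k i : exists s, mderiv k (bary T i) = mpolyC 2 s.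
Proof.
exists (\sum_(j < 2) invmx (vertex_mx T) (lift ord0 j) i * (j == k)%:R).
rewrite /bary mderivD mderivC add0r raddf_sum [RHS]raddf_sum.
apply: eq_bigr => j _ /=; rewrite mderivZ mderivX mnm1E.
case: eqP => [->|_].
  rewrite mulr1 scale1r (_ : mnm_sub _ _ = mnm0); last first.
    by apply/mnmP => x; rewrite mnmBE mnm0E subnn.
  by rewrite mpolyX0 -mul_mpolyC mulr1.
by rewrite scale0r mulr0 scaler0 mpolyC0.
Qed.

Lemma mderiv_exp k (p : mpoly 2 R) n :
  mderiv k (p ^+ n) = n%:R *: (p ^+ n.-1 * mderiv k p).
Proof.
elim: n => [|n IH]; first by rewrite expr0 -mpolyC1 mderivC scale0r.
rewrite exprS mderivM IH /=; case: n {IH} => [|n] /=.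
  by rewrite !expr0 scale0r mulr0 addr0 scale1r mulrC.
rewrite -scalerAr mulrA -exprS -[n.+2%:R]natr1 scalerDl scale1r addrC.
by congr (_ + _); rewrite mulrC.
Qed.

Lemma is_bpoly_mderiv_mono (T : triangle R) d k a b c : (a + b + c)%N = d.+1 ->
  is_bpoly T d (mderiv k (bary_mono T a b c)).
Proof.
move=> abc.
have [s0 e0] := mderiv_bary T k ord0.
have [s1 e1] := mderiv_bary T k (lift ord0 ord0).
have [s2 e2] := mderiv_bary T k ord_max.
rewrite /bary_mono !mderivM !mderiv_exp e0 e1 e2.
have -> (x y z : mpoly 2 R) : (x * y + z) = x * y + z by [].
set p0 := bary T ord0; set p1 := bary T _; set p2 := bary T ord_max.
have -> : (a%:R *: (p0 ^+ a.-1 * mpolyC 2 s0) * p1 ^+ b +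
   p0 ^+ a * (b%:R *: (p1 ^+ b.-1 * mpolyC 2 s1))) * p2 ^+ c +
  p0 ^+ a * p1 ^+ b * (c%:R *: (p2 ^+ c.-1 * mpolyC 2 s2)) =
  (a%:R * s0) *: bary_mono T a.-1 b c + (b%:R * s1) *: bary_mono T a b.-1 c +
  (c%:R * s2) *: bary_mono T a b c.-1.
  by rewrite /bary_mono -/p0 -/p1 -/p2 -!mul_mpolyC !mpolyCM; ring.
have Z n s p : (0 < n -> is_bpoly T d p)%N -> is_bpoly T d ((n%:R * s) *: p).
  case: n => [_|n h]; last by apply/is_bpolyZ/h.
  by rewrite mul0r scale0r; apply: is_bpoly0.
apply: is_bpolyD; first apply: is_bpolyD; apply: Z => h; apply: is_bpoly_mono.
- by apply: succn_inj; rewrite -abc -{2}(prednK h) !addSn.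
- by apply: succn_inj; rewrite -abc -{2}(prednK h) addnS !addSn.
- by apply: succn_inj; rewrite -abc -{2}(prednK h) addnS.
Qed.

Lemma is_bpoly_mderiv (T : triangle R) d k (c : 'cV[R]_(bdim d.+1)) :
  is_bpoly T d (mderiv k (bpoly T c)).
Proof.
rewrite /bpoly raddf_sum; elim/big_ind : _ => [|p q|j _ /=].
- exact: is_bpoly0.
- exact: is_bpolyD.
- rewrite mderivZ bernsteinE mderivZ; do 2!apply: is_bpolyZ.
  exact/is_bpoly_mderiv_mono/bidxE.
Qed.

Lemma bcoef_mderiv (T : triangle R) d k (c : 'cV[R]_(bdim d.+1)) :
  bpoly T (bcoef T d (mderiv k (bpoly T c))) = mderiv k (bpoly T c).
Proof. by have [c' <-] := is_bpoly_mderiv T k c; rewrite bcoefK. Qed.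

Lemma edge_poly_is_linear m t : linear (fun r : 'cV[R]_m.+1 => edge_poly r t).
Proof.
move=> a r r'; rewrite /edge_poly scaler_sumr -big_split /=.
by apply: eq_bigr => j _; rewrite !mxE /GRing.scale /=; ring.
Qed.

Lemma edge_poly_eq0 m (r : 'cV[R]_m.+1) :
  (forall t, edge_poly r t = 0) -> r = 0.
Proof.
move=> r0; apply/colP => j; rewrite mxE.
have H (s : nat) : \sum_(j < m.+1) (r j 0 * 'C(m, j)%:R) * s%:R ^+ j = 0.
  pose z : R := 1 + s%:R.
  have z0 : z != 0 by rewrite gt_eqF// ltr_wpDr// ler0n.
  have zE : 1 - s%:R / z = 1 / z.
    by rewrite -{1}(divff z0) -mulrBl /z addrK.
  have /(congr1 ( *%R (z ^+ m))) := r0 (s%:R / z).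
  rewrite mulr0 => H0; rewrite -[RHS]H0 /edge_poly mulr_sumr.
  apply: eq_bigr => i _; rewrite zE !expr_div_n expr1n.
  have im : (i <= m)%N by rewrite -ltnS.
  rewrite -[in z ^+ m](subnKC im) exprD.
  have := expf_neq0 i z0; have := expf_neq0 (m - i)%N z0.
  move: (z ^+ i) (z ^+ (m - i)) ('C(m, i)%:R : R) (s%:R ^+ i : R) => p q x y p0 q0.
  by field; rewrite p0 q0.
have := sum_powers0 H j; rewrite (big_pred1 j) => [|i]; last by rewrite /= val_eqE.
move/eqP; rewrite mulf_eq0 => /orP[/eqP//|].
by rewrite pnatr_eq0 -leqn0 leqNgt bin_gt0 -ltnS ltn_ord.
Qed.

Lemma edge_poly_inj m (r r' : 'cV[R]_m.+1) :
  (forall t, edge_poly r t = edge_poly r' t) -> r = r'.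
Proof.
move=> h; apply/eqP; rewrite -subr_eq0; apply/eqP/edge_poly_eq0 => t.
rewrite -scaleN1r addrC; have := @edge_poly_is_linear m t (-1) r' r.
by move=> /= ->; rewrite h scaleN1r addNr.
Qed.

Definition is_edge_poly m (f : R -> R) :=
  exists r : 'cV[R]_m.+1, forall t, f t = edge_poly r t.

Lemma is_edge_polyD m f g : is_edge_poly m f -> is_edge_poly m g -> is_edge_poly m (fun t => f t + g t).
Proof.
move=> [r e] [r' e']; exists (1 *: r + r') => t.
by have /= -> := @edge_poly_is_linear m t 1 r r'; rewrite scale1r e e'.
Qed.

Lemma is_edge_poly0 m : is_edge_poly m (fun => 0).
Proof.
by exists 0 => t; rewrite /edge_poly big1// => i _; rewrite mxE !mul0r.
Qed.

Lemma is_edge_polyZ m a f : is_edge_poly m f -> is_edge_poly m (fun t => a * f t).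
Proof.
move=> [r e]; exists (a *: r) => t.
rewrite e /edge_poly mulr_sumr; apply: eq_bigr => i _; rewrite mxE; ring.
Qed.

Lemma is_edge_poly_pow m i j : (i + j)%N = m -> is_edge_poly m (fun t => t ^+ i * (1 - t) ^+ j).
Proof.
move=> ijm; have im : (i < m.+1)%N by rewrite ltnS -ijm leq_addr.
exists (\col_k if k == Ordinal im then ('C(m, i)%:R)^-1 else 0) => t.
rewrite /edge_poly (bigD1 (Ordinal im))//= big1 ?addr0.
  rewrite mxE eqxx mulVf ?mul1r; first by rewrite -ijm addKn.
  by rewrite pnatr_eq0 -lt0n bin_gt0 -ltnS.
by move=> k /negPf kE; rewrite mxE kE !mul0r.
Qed.

Lemma is_edge_poly_mul m f p q : is_edge_poly m f ->
  is_edge_poly m.+1 (fun t => ((1 - t) * p + t * q) * f t).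
Proof.
move=> [r e].
have H (P : R -> R) : (forall j : 'I_m.+1,
     is_edge_poly m.+1 (fun t => P t * (t ^+ j * (1 - t) ^+ (m - j)))) ->
    is_edge_poly m.+1 (fun t => P t * f t).
  move=> h.
  suff [r' e'] : is_edge_poly m.+1 (fun t => \sum_(j < m.+1) (r j 0 * 'C(m, j)%:R) *
      (P t * (t ^+ j * (1 - t) ^+ (m - j)))).
    exists r' => t; rewrite -e' e /edge_poly mulr_sumr.
    by apply: eq_bigr => j _; ring.
  elim: (index_enum _) => [|j s [r' IH]].
    by have [r' h'] := is_edge_poly0 m.+1; exists r' => t; rewrite big_nil -h'.
  have [r'' h'] := is_edge_polyD (is_edge_polyZ (r j 0 * 'C(m, j)%:R) (h j)) (ex_intro _ r' IH).
  by exists r'' => t; rewrite big_cons -h'.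
have [r1 h1] : is_edge_poly m.+1 (fun t => (1 - t) * f t).
  apply: H => j; have [|r' h'] := @is_edge_poly_pow m.+1 j (m - j).+1.
    by rewrite addnS subnKC// -ltnS.
  by exists r' => t; rewrite -h' exprS; ring.
have [r2 h2] : is_edge_poly m.+1 (fun t => t * f t).
  apply: H => j; have [|r' h'] := @is_edge_poly_pow m.+1 j.+1 (m - j).
    by rewrite addSn subnKC// -ltnS.
  by exists r' => t; rewrite -h' exprS; ring.
have [r3 h3] := is_edge_polyD (is_edge_polyZ p (ex_intro _ r1 h1)) (is_edge_polyZ q (ex_intro _ r2 h2)).
by exists r3 => t; rewrite -h3; ring.
Qed.

Lemma peval_bary_line (T : triangle R) i (a b : 'rV[R]_2) t :
  peval (bary T i) (a + t *: (b - a)) =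
  (1 - t) * peval (bary T i) a + t * peval (bary T i) b.
Proof.
rewrite /peval /bary !mevalD !mevalC !mulrDr addrACA; congr (_ + _).
  by rewrite -mulrDl subrK mul1r.
rewrite !raddf_sum !mulr_sumr -big_split; apply: eq_bigr => k _ /=.
by rewrite !mevalZ !mevalXU !mxE; ring.
Qed.

Lemma is_edge_poly_bpoly (T : triangle R) m (c : 'cV[R]_(bdim m)) (a b : 'rV[R]_2) :
  is_edge_poly m (fun t => peval (bpoly T c) (a + t *: (b - a))).
Proof.
have M n0 n1 n2 : is_edge_poly (n0 + n1 + n2) (fun t =>
    peval (bary_mono T n0 n1 n2) (a + t *: (b - a))).
  have S i n q : is_edge_poly n (fun t => peval q (a + t *: (b - a))) ->
      is_edge_poly n.+1 (fun t => peval (bary T i * q) (a + t *: (b - a))).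
    move=> /is_edge_poly_mul => /(_ (peval (bary T i) a) (peval (bary T i) b))[r h].
    by exists r => t; rewrite -h -peval_bary_line /peval mevalM.
  rewrite /bary_mono; elim: n2 => [|n2 IH]; last first.
    by rewrite addnS exprS mulrCA; apply: S.
  elim: n1 => [|n1 IH]; last first.
    by rewrite addnS addSn exprS (mulrCA (_ ^+ n0)) -mulrA; apply: S.
  elim: n0 => [|n0 IH]; last by rewrite !addSn exprS -!mulrA; apply: S; rewrite mulrA.
  have [//|r h] := @is_edge_poly_pow 0 0 0.
  by exists r => t; rewrite -h !expr0 /peval !mulr1 meval1.
rewrite /bpoly.
suff [r h] : is_edge_poly m (fun t => \sum_k (c k 0 *
   (m`!%:R / (\prod_i (enum_val k i)`!)%:R)) *
   peval (bary_mono T (enum_val k ord0) (enum_val k (lift ord0 ord0))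
     (enum_val k ord_max)) (a + t *: (b - a))).
  exists r => t; rewrite -h /peval raddf_sum; apply: eq_bigr => k _ /=.
  by rewrite bernsteinE !mevalZ mulrA.
elim: (index_enum _) => [|k s [r IH]].
  by have [r h'] := is_edge_poly0 m; exists r => t; rewrite big_nil -h'.
have h := M (enum_val k ord0) (enum_val k (lift ord0 ord0)) (enum_val k ord_max).
rewrite bidxE in h.
have [r'' h'] := is_edge_polyD (is_edge_polyZ (c k 0 * (m`!%:R / (\prod_i (enum_val k i)`!)%:R)) h)
  (ex_intro _ r IH).
by exists r'' => t; rewrite big_cons -h'.
Qed.

Lemma edge_coefE m a b p (r : 'cV[R]_m.+1) :
  (forall t, peval p (a + t *: (b - a)) = edge_poly r t) ->
  edge_coef m a b p = r.
Proof.
move=> h; apply: edge_poly_inj => t; rewrite -h /edge_coef.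
have := xgetPex 0 (P := [set r | forall t, peval p (a + t *: (b - a)) = edge_poly r t]).
by move=> /(_ m (ex_intro _ r h))/(_ t) ->.
Qed.

Lemma edge_coef_bpoly (T : triangle R) m (c : 'cV[R]_(bdim m)) a b t :
  edge_poly (edge_coef m a b (bpoly T c)) t =
  peval (bpoly T c) (a + t *: (b - a)).
Proof. by have [r h] := is_edge_poly_bpoly T c a b; rewrite (edge_coefE h). Qed.

Lemma edge_coef_is_linear (T : triangle R) m a b :
  linear (fun c : 'cV[R]_(bdim m) => edge_coef m a b (bpoly T c)).
Proof.
move=> x c c'; apply: edge_coefE => t.
have /= -> := @edge_poly_is_linear m t x
  (edge_coef m a b (bpoly T c)) (edge_coef m a b (bpoly T c')).
by rewrite !edge_coef_bpoly bpoly_is_linear /peval mevalD mevalZ.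
Qed.

End WellDefined.

Section MatrixAction.
Variables (R : realType) (n : nat) (T : 'I_n -> triangle R).
Variable E : interior_edges T.

Lemma matrix_of_mul p q (f : 'cV[R]_q -> 'cV[R]_p) :
  linear f -> forall u, matrix_of f *m u = f u.
Proof.
move=> flin u.
have f0 : f 0 = 0 by have := flin (-1) 0 0; rewrite !scaleN1r oppr0 add0r addNr.
have fZ a x : f (a *: x) = a *: f x by have := flin a x 0; rewrite f0 !addr0.
have fD x y : f (x + y) = f x + f y by have := flin 1 x y; rewrite !scale1r.
rewrite [in RHS](matrix_sum_delta u) (big_morph f fD f0); apply/colP => i.
rewrite !mxE summxE; apply: eq_bigr => j _.
by rewrite big_ord1 fZ !mxE mulrC.
Qed.

Lemma mxcol_is_linear k q (p_ : 'I_k -> nat)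
    (f : forall i, 'cV[R]_q -> 'cV[R]_(p_ i)) :
  (forall i, linear (f i)) -> linear (fun u => \mxcol_i f i u).
Proof. by move=> flin a u u'; apply/colP => j; rewrite !mxE flin !mxE. Qed.

Lemma sub_is_linear p q (f g : 'cV[R]_q -> 'cV[R]_p) :
  linear f -> linear g -> linear (fun u => f u - g u).
Proof. by move=> fl gl a u u'; rewrite fl gl scalerBr opprD addrACA. Qed.

Lemma spiece_is_linear m i : linear (fun u : spline R n m => spiece T u i).
Proof.
move=> a u u'; rewrite /spiece -bpoly_is_linear; congr bpoly.
by apply/colP => j; rewrite !mxE.
Qed.

Lemma broken_partial_spiece d k (u : spline R n d.+1) i :
  spiece T (broken_partial T k u) i = mderiv k (spiece T u i).
Proof. by rewrite {1}/spiece mxcolK bcoef_mderiv. Qed.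

Lemma broken_grad_is_linear d : linear (@broken_grad R n T d).
Proof.
move=> a u u'.
suff H k : broken_partial T k (a *: u + u') =
    a *: broken_partial T k u + broken_partial T k u'.
  by rewrite /broken_grad !H scale_col_mx add_col_mx.
apply/mxcolP => i; apply: (@bpoly_inj R (T i)).
rewrite -!/(spiece T _ i) spiece_is_linear !broken_partial_spiece.
by rewrite spiece_is_linear mderivD mderivZ.
Qed.

Lemma jump_is_linear m : linear (@jump R n T E m).
Proof.
have H (e : 'I_(nedge E)) i :
    linear (fun u : spline R n m => edge_coef m (eorg e) (edst e) (spiece T u i)).
  move=> a u u'; rewrite -edge_coef_is_linear bpoly_is_linear.
  by rewrite spiece_is_linear.
by apply: mxcol_is_linear => e; apply: sub_is_linear; apply: H.
Qed.

Lemma vpiece_dotE m (v : vspline R n m) i w : vpiece_dot T v i w =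
  bpoly (T i) (w 0 0 *: submxcol (usubmx v) i + w 0 1 *: submxcol (dsubmx v) i).
Proof.
rewrite bpoly_is_linear; congr (_ + _).
rewrite /spiece /bpoly scaler_sumr; apply: eq_bigr => k _.
by rewrite scalerA; congr (_ *: _); rewrite !mxE.
Qed.

Lemma tangential_jump_is_linear m : linear (@tangential_jump R n T E m).
Proof.
have H (e : 'I_(nedge E)) i w : linear (fun v : vspline R n m =>
    edge_coef m (eorg e) (edst e) (vpiece_dot T v i w)).
  move=> a v v'; rewrite !vpiece_dotE -edge_coef_is_linear.
  congr (edge_coef _ _ _ (bpoly _ _)).
  by apply/colP => j; rewrite !mxE; ring.
by apply: mxcol_is_linear => e; apply: sub_is_linear; apply: H.
Qed.

Lemma D0br_mul d u : D0br T d *m u = broken_grad T u.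
Proof. exact/matrix_of_mul/broken_grad_is_linear. Qed.

Lemma C0_mul m u : C0 E m *m u = jump E u.
Proof. exact/matrix_of_mul/jump_is_linear. Qed.

Lemma C1curl_mul m v : C1curl E m *m v = tangential_jump E v.
Proof. exact/matrix_of_mul/tangential_jump_is_linear. Qed.

End MatrixAction.

(* Main.v *)
Require Import Defs.
From mathcomp Require Import all_boot all_order all_algebra.
From mathcomp Require Import all_classical all_reals all_analysis.
From mathcomp Require Import -(notations) mpoly.
From mathcomp Require Import ring.

Set Implicit Arguments.
Unset Strict Implicit.
Unset Printing Implicit Defensive.

Import GRing.Theory.

Local Open Scope classical_set_scope.
Local Open Scope ring_scope.

(** The restriction to an edge [a, b] of a polynomial p is a univariate
    polynomial in t, and by the chain rule its derivative is the restriction of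
    the directional derivative of p along b - a.  In Bernstein form,
    differentiating a univariate polynomial of degree m amounts to applying the
    difference matrix U_m to its coefficients; dividing by |e| turns b - a into
    the unit tangent.  This gives the commutation on each side of every edge,
    hence for the jumps. *)

Section ChainRule.
Variables (R : comNzRingType) (n : nat) (g : 'I_n -> {poly R}).

(** [mmap polyC g p] is p composed with the polynomial curve g; evaluation at t respects its sums
    and products. *)
Lemma horner_mmap (p : mpoly n R) t :
  (mmap polyC g p).[t] = meval (fun k => (g k).[t]) p.
Proof.
rewrite /meval /mmap horner_sum; apply: eq_bigr => m _.
rewrite hornerM hornerC horner_prod; congr (_ * _).
by apply: eq_bigr => k _; rewrite horner_exp.
Qed.

(** Chain rule for formal derivatives: by the Leibniz rule on both sides the identity passes to
    products, and by additivity to sums, so constants and single variables suffice. *)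
Lemma deriv_mmap (p : mpoly n R) :
  (mmap polyC g p)^`() = \sum_k (g k)^`() * mmap polyC g (mderiv k p).
Proof.
pose P p := (mmap polyC g p)^`() = \sum_k (g k)^`() * mmap polyC g (mderiv k p).
have PM q r : P q -> P r -> P (q * r).
  rewrite /P rmorphM derivM => -> ->.
  rewrite mulr_suml mulr_sumr -big_split; apply: eq_bigr => k _ /=.
  by rewrite mderivM mmapD !rmorphM /=; ring.
have PC c : P (mpolyC n c).
  by rewrite /P mmapC derivC big1// => k _; rewrite mderivC mmap0 mulr0.
have PX (i : 'I_n) : P (mpolyX R (mnm1 i)).
  rewrite /P mmapX mmap1U (bigD1 i)//= big1 => [|k ki].
    rewrite mderivX mnm1E eqxx scale1r addr0 (_ : mnm_sub _ _ = mnm0).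
      by rewrite mpolyX0 mmapC mulr1.
    by apply/mnmP => x; rewrite mnmBE mnm0E subnn.
  by rewrite mderivX mnm1E eq_sym (negPf ki) scale0r mmap0 mulr0.
elim/mpolyind : p => [|c m p _ _ IH]; first exact: (PC 0).
have Pm : P (mpolyX R m).
  rewrite mpolyXE_id; elim/big_ind : _ => [|//|i _]; first exact: (PC 1).
  by elim: (m i) => [|k IHk]; [exact: (PC 1)|rewrite exprS; apply: PM].
have := PM _ _ (PC c) Pm; rewrite /P mul_mpolyC mmapD derivD => -> //.
rewrite IH -big_split; apply: eq_bigr => k _ /=.
by rewrite mderivD mmapD mulrDr.
Qed.

End ChainRule.

Section Edge.
Variable R : realType.

(** The function [edge_poly r] as a formal polynomial, so that the algebraic derivative applies to
    it. *)
Definition edge_bernstein m (r : 'cV[R]_m.+1) : {poly R} :=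
  \sum_(j < m.+1) (r j 0 * 'C(m, j)%:R) *: ('X^j * (1 - 'X) ^+ (m - j)).

Lemma horner_edge_bernstein m (r : 'cV[R]_m.+1) t :
  (edge_bernstein r).[t] = edge_poly r t.
Proof.
rewrite horner_sum; apply: eq_bigr => j _.
by rewrite hornerZ hornerM hornerXn horner_exp hornerD hornerN hornerC hornerX mulrA.
Qed.

Lemma Udiff_mulE m (r : 'cV[R]_m.+2) j :
  (Udiff R m.+1 *m r) j 0 =
  m.+1%:R * (r (lift ord0 j) 0 - r (widen_ord (leqnSn _) j) 0).
Proof.
rewrite -scalemxAl !mxE; congr (_ * _).
under eq_bigr do rewrite mxE mulrBl.
rewrite sumrB (bigD1 (lift ord0 j))//= big1 => [|k kj].
  rewrite eqxx mul1r addr0 (bigD1 (widen_ord (leqnSn _) j))//= big1 => [|k kj].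
    by rewrite eqxx mul1r addr0.
  by rewrite (_ : (k == j :> nat) = false) ?mul0r//; apply: negPf.
by rewrite (_ : (k == j.+1 :> nat) = false) ?mul0r//; apply: negPf.
Qed.

Lemma deriv_edge_bernstein m (r : 'cV[R]_m.+2) :
  (edge_bernstein r)^`() = edge_bernstein (Udiff R m.+1 *m r).
Proof.
pose b j : {poly R} := 'X^j * (1 - 'X) ^+ (m - j).
(* The truncated exponents [j.-1] at j = 0 and [m - j] at j = m+1 are harmless: their multiplicities
   [j] and [m.+1 - j] vanish there. *)
have dB (j : 'I_m.+2) :
    deriv ('X^j * (1 - 'X) ^+ (m.+1 - j) : {poly R}) =
    ('X^(j.-1) * (1 - 'X) ^+ (m.+1 - j)) *+ j - b j *+ (m.+1 - j).
  rewrite derivM derivXn deriv_exp derivB derivC derivX sub0r mulN1r.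
  by rewrite mulNrn mulrN mulrnAl mulrnAr -subnS subSS.
(* The first sum loses its term j = 0 and is shifted by one, the second loses j = m+1. The weights
   then agree by (j+1) C(m+1,j+1) = (m+1) C(m,j) = (m+1-j) C(m+1,j). *)
transitivity (\sum_(j < m.+1) (m.+1%:R * 'C(m, j)%:R * r (lift ord0 j) 0) *: b j
  - \sum_(j < m.+1) (m.+1%:R * 'C(m, j)%:R * r (widen_ord (leqnSn _) j) 0) *: b j).
  rewrite raddf_sum; under eq_bigr do rewrite /= derivZ dB scalerBr.
  rewrite sumrB; congr (_ - _).
    rewrite big_ord_recl mulr0n scaler0 add0r; apply: eq_bigr => j _.
    rewrite lift0 /= subSS -/(b j) -scalerMnr scalerMnl -[_ *+ _]mulr_natr.
    rewrite -natrM mul_bin_diag natrM.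
    by congr (_ *: _); ring.
  rewrite big_ord_recr /= subnn mulr0n scaler0 addr0; apply: eq_bigr => j _.
  rewrite -scalerMnr scalerMnl -[_ *+ _]mulr_natr -natrM (mul_bin_down m.+1 j) natrM.
  by congr (_ *: _); ring.
rewrite -sumrB; apply: eq_bigr => j _.
by rewrite Udiff_mulE -scalerBl; congr (_ *: _); ring.
Qed.

Lemma edge_coef_directional m (a b w : 'rV[R]_2) (s : R) (p : mpoly 2 R)
    (r : 'cV[R]_m.+2) : w = s *: (b - a) ->
  (forall t, peval p (a + t *: (b - a)) = edge_poly r t) ->
  edge_coef m a b (w 0 0 *: mderiv 0 p + w 0 1 *: mderiv 1 p) =
  s *: (Udiff R m.+1 *m r).
Proof.
move=> -> pr.
(* The affine parametrization of the line through a and b, with constant derivative b - a. *)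
pose g k : {poly R} := (a 0 k)%:P + (b - a) 0 k *: 'X.
have gE q t : (mmap polyC g q).[t] = peval q (a + t *: (b - a)).
  rewrite horner_mmap; congr (meval _ q); apply/funext => k.
  by rewrite !hornerE !mxE; ring.
have gr : mmap polyC g p = edge_bernstein r.
  (* The two polynomials agree at every natural number, hence their difference has infinitely many
     roots. *)
  apply/eqP; rewrite -subr_eq0; apply/eqP/poly_nat0 => k.
  by rewrite hornerD hornerN gE pr horner_edge_bernstein subrr.
apply: edge_coefE => t.
have := congr1 (fun q => s * q.[t]) (deriv_mmap g p).
rewrite gr deriv_edge_bernstein horner_edge_bernstein => sE.
transitivity (s * edge_poly (Udiff R m.+1 *m r) t).
  rewrite sE big_ord_recl big_ord1 hornerD !hornerM !gE /g !derivD !derivC.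
  rewrite !derivZ !derivX !hornerE /peval !mevalD !mevalZ !mxE.
  by rewrite (_ : lift ord0 ord0 = 1 :> 'I_2); [ring|apply/val_inj].
rewrite /edge_poly mulr_sumr; apply: eq_bigr => j _.
by move: (Udiff R m.+1 *m r) => v; rewrite mxE; ring.
Qed.

End Edge.

Section Commutation.
Variables (R : realType) (n : nat) (T : 'I_n -> triangle R).
Variables (E : interior_edges T) (d : nat).

Lemma edge_coef_broken_grad (e : 'I_(nedge E)) (u : spline R n d.+1) i :
  edge_coef d (eorg e) (edst e)
    (vpiece_dot T (broken_grad T u) i (tangent (eorg e) (edst e))) =
  (elen (eorg e) (edst e))^-1 *:
    (Udiff R d.+1 *m edge_coef d.+1 (eorg e) (edst e) (spiece T u i)).
Proof.
rewrite /vpiece_dot /broken_grad col_mxKu col_mxKd !broken_partial_spiece.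
(* By definition the tangent is b - a scaled by s = 1/|e|. *)
by apply: edge_coef_directional => // t; rewrite edge_coef_bpoly.
Qed.

Lemma tangential_jump_broken_grad (u : spline R n d.+1) :
  tangential_jump E (broken_grad T u) = B0 E d *m jump E u.
Proof.
rewrite /B0 /jump mul_mxblock_mxrow; apply: eq_mxcol => e.
(* In block row e of [B0] only the diagonal block survives. *)
rewrite (bigD1 e)//= eqxx big1 => [|e' ee']; last first.
  by rewrite eq_sym (negPf ee') mul0mx.
have H := edge_coef_broken_grad e u.
rewrite addr0; apply: etrans (congr2 (fun r r' => r - r') (H (tplus e)) (H (tminus e))) _.
rewrite /edge_jump.
move: (edge_coef _ _ _ _) (edge_coef _ _ _ _) (Udiff _ _) (_^-1) => r r' U s.
by rewrite -scalemxAl mulmxBr scalerBr.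
Qed.

Lemma C1curl_D0br : C1curl E d *m D0br T d = B0 E d *m C0 E d.+1.
Proof.
(* Applying A and B to the basis vectors compares them column by column. *)
have cancel_delta p q (A B : 'M[R]_(p, q)) :
    (forall u : 'cV_q, A *m u = B *m u) -> A = B.
  by move=> AB; apply/matrixP => i j; have /colP/(_ i) := AB (delta_mx j 0);
    rewrite -!colE !mxE.
apply: cancel_delta => u.
by rewrite -!mulmxA D0br_mul C1curl_mul C0_mul tangential_jump_broken_grad.
Qed.

End Commutation.

Theorem theorem4p2 (R : realType) (n : nat) (T : 'I_n -> triangle R)
    (Omega : set 'rV[R]_2) (hT : regular_triangulation T Omega)
    (E : interior_edges T) (d : nat) (hd : (1 <= d)%N) :
  C1curl E d *m D0br T d = B0 E d *m C0 E d.+1 /\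
  [set D0br T d *m u | u in [set u : spline R n d.+1 | C0 E d.+1 *m u = 0]]
    `<=` [set v : vspline R n d | C1curl E d *m v = 0].
Proof.
split; first exact: C1curl_D0br.
(* For u in the kernel, C1 D0 u = B0 (C0 u) = B0 0 = 0. *)
by move=> _ [u /= u0 <-]; rewrite mulmxA C1curl_D0br -mulmxA u0 mulmx0.
Qed.
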